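(* Let $A,Q\in\mathbb{R}^{n\times n}$ be nonsingular and let $\tau>0$. If $$0<\Vert A^{-1}Q\Vert\Vert Q^{-1}\Vert<1\quad\text{and}\quad 0<\tau<\frac{2}{1+\Vert A^{-1}Q\Vert\Vert Q^{-1}\Vert},$$ then for any $b\in\mathbb{R}^n$ the equation $Ax-|x|-b=0$ has a unique solution $x^*\in\mathbb{R}^n$, and the sequence $\{(x^{(k)},y^{(k)})\}_{k=0}^\infty$ generated by the MFPI iteration converges to $(x^*,y^* )$ with $y^*=Q^{-1}|x^*|$ for any given initial vectors $x^{(0)},y^{(0)}\in\mathbb{R}^n$.
   Context: For $x\in\mathbb{R}^n$, $|x|$ is the componentwise absolute value. $\Vert\cdot\Vert$ is the matrix 2-norm. The MFPI (modified fixed point iteration) for $Ax-|x|-b=0$ with parameters $\tau=\tau_{\rm MFPI}$, $Q=Q_{\rm MFPI}$ is, for $k=0,1,2,\dots$, $$x^{(k+1)}=A^{-1}(Qy^{(k)}+b),\qquad y^{(k+1)}=(1-\tau)y^{(k)}+\tau Q^{-1}|x^{(k+1)}|.$$ *)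

(* Defs.v *)
From HB Require Import structures.
From mathcomp Require Import all_boot all_order all_algebra.
From mathcomp Require Import all_classical all_reals all_analysis.

Set Implicit Arguments.
Unset Strict Implicit.
Unset Printing Implicit Defensive.

Import Order.TTheory GRing.Theory Num.Theory.
Import numFieldNormedType.Exports.

Local Open Scope classical_set_scope.
Local Open Scope ring_scope.

(* On matrices `|x| is the library's entrywise max norm, a scalar; this is the
   componentwise absolute value, a vector. *)
Definition cvabs (R : realType) (n : nat) (x : 'cV[R]_n) : 'cV[R]_n :=
  map_mx (fun t : R => `|t|) x.

Definition cvnorm2 (R : realType) (n : nat) (x : 'cV[R]_n) : R :=
  Num.sqrt (\sum_(i < n) x i 0 ^+ 2).

(* The set is nonempty (x = 0) and, in finite dimension, bounded, so that sup
   does not take its default value 0 here. *)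
Definition mxnorm2 (R : realType) (m n : nat) (M : 'M[R]_(m, n)) : R :=
  sup [set cvnorm2 (M *m x) | x in [set x : 'cV[R]_n | cvnorm2 x <= 1]].

Definition mfpi_step (R : realType) (n : nat) (A Q : 'M[R]_n) (b : 'cV[R]_n)
    (tau : R) (p : 'cV[R]_n * 'cV[R]_n) : 'cV[R]_n * 'cV[R]_n :=
  let x := invmx A *m (Q *m p.2 + b) in
  (x, (1 - tau) *: p.2 + tau *: (invmx Q *m cvabs x)).

Definition mfpi (R : realType) (n : nat) (A Q : 'M[R]_n) (b : 'cV[R]_n)
    (tau : R) (x0 y0 : 'cV[R]_n) (k : nat) : 'cV[R]_n * 'cV[R]_n :=
  iter k (mfpi_step A Q b tau) (x0, y0).

(* Main.v *)
Require Import Defs.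
From HB Require Import structures.
From mathcomp Require Import all_boot all_order all_algebra.
From mathcomp Require Import all_classical all_reals all_analysis.
From mathcomp Require Import ring lra.

Set Implicit Arguments.
Unset Strict Implicit.
Unset Printing Implicit Defensive.

Import Order.TTheory GRing.Theory Num.Theory.
Import numFieldNormedType.Exports.

Local Open Scope classical_set_scope.
Local Open Scope ring_scope.

(** The iteration decouples: every step recomputes [x] from [y], so [y] follows
    the orbit of the single map
      T y = (1 - tau) y + tau Q^-1 |A^-1 (Q y + b)|
    ([mfpi_map]), and [x] is an affine function of the previous [y].

    Since the componentwise absolute value is 1-Lipschitz for the Euclidean norm
    ([cvnorm2_cvabsB]), T is Lipschitz with constant |1 - tau| + tau nu, where
    nu = ||A^-1 Q|| ||Q^-1|| ([mfpi_map_lipschitz]), and the hypotheses on [nu]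
    and [tau] say that this constant is less than 1 ([relaxation_factor_lt1]).
    Hence T has a unique fixed point and its orbits converge to it
    geometrically.

    As [tau] is nonzero, y is fixed by T exactly when y = Q^-1 |x| for
    x = A^-1 (Q y + b) ([mfpi_map_fixP]), that is, when this x solves the
    equation ([abs_eq_solutionP]). This gives existence and uniqueness of the
    solution, and the error bound for y carries over to x.

    The topology of ['cV[R]_n] comes from the max norm, whereas T contracts the
    Euclidean one; the fixed point is therefore obtained from an iterate of T
    that contracts the max norm too ([cvnorm2_contraction_fixpoint]). *)

(** * The Euclidean norm and the spectral norm *)

Lemma cvnorm2_ge0 (R : realType) (n : nat) (x : 'cV[R]_n) : 0 <= cvnorm2 x.
Proof. exact: sqrtr_ge0. Qed.

Lemma sqr_cvnorm2 (R : realType) (n : nat) (x : 'cV[R]_n) :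
  cvnorm2 x ^+ 2 = \sum_(i < n) x i 0 ^+ 2.
Proof. by rewrite sqr_sqrtr// sumr_ge0// => i _; exact: sqr_ge0. Qed.

Lemma cvnorm20 (R : realType) (n : nat) : cvnorm2 (0 : 'cV[R]_n) = 0.
Proof.
by rewrite /cvnorm2 big1 ?sqrtr0// => i _; rewrite mxE expr0n.
Qed.

Lemma cvnorm2Z (R : realType) (n : nat) (a : R) (x : 'cV[R]_n) :
  cvnorm2 (a *: x) = `|a| * cvnorm2 x.
Proof.
rewrite /cvnorm2 -sqrtr_sqr -sqrtrM ?sqr_ge0// mulr_sumr; congr Num.sqrt.
by apply: eq_bigr => i _; rewrite mxE exprMn.
Qed.

Lemma ler_entry_mx_norm (R : realType) (m n : nat) (M : 'M[R]_(m, n)) i j :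
  `|M i j| <= `|M|.
Proof.
rewrite [leRHS]/Num.norm/= mx_normrE.
exact: (le_bigmax _ (fun ij : 'I_m * 'I_n => `|M ij.1 ij.2|) (i, j)).
Qed.

Lemma normr_le_cvnorm2 (R : realType) (n : nat) (x : 'cV[R]_n) :
  `|x| <= cvnorm2 x.
Proof.
rewrite /Num.norm/= mx_normrE; apply: bigmax_le => [|[i j] _ /=].
  exact: cvnorm2_ge0.
rewrite ord1 -(ler_pXn2r (n := 2)) ?nnegrE ?cvnorm2_ge0//.
rewrite sqr_cvnorm2 real_normK ?num_real// (bigD1 i)//= lerDl.
by rewrite sumr_ge0// => k _; exact: sqr_ge0.
Qed.

Lemma cvnorm2_eq0 (R : realType) (n : nat) (x : 'cV[R]_n) :
  cvnorm2 x = 0 -> x = 0.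
Proof.
by move=> x0; apply/eqP; rewrite -normr_le0 -x0; exact: normr_le_cvnorm2.
Qed.

(** Together with [normr_le_cvnorm2], the Euclidean norm is equivalent to the
    max norm, which defines the topology of ['cV[R]_n]; the crude constant [n]
    (in place of its square root) suffices for that. *)
Lemma cvnorm2_le_normr (R : realType) (n : nat) (x : 'cV[R]_n) :
  cvnorm2 x <= n%:R * `|x|.
Proof.
rewrite -(ler_pXn2r (n := 2)) ?nnegrE ?cvnorm2_ge0 ?mulr_ge0//.
rewrite sqr_cvnorm2.
apply: (@le_trans _ _ (\sum_(i < n) `|x| ^+ 2)).
  apply: ler_sum => i _; rewrite -[leLHS]real_normK ?num_real//.
  by rewrite lerXn2r ?nnegrE// ler_entry_mx_norm.
rewrite sumr_const card_ord -[leLHS]mulr_natl exprMn ler_wpM2r ?sqr_ge0//.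
by rewrite -natrX ler_nat; case: n {x} => // n; rewrite expnS leq_pmulr.
Qed.

(** With a and b the norms of x and y, both positive, convexity of the square
    gives entry by entry
    (x_i + y_i)^2 <= (a + b) (x_i^2 / a + y_i^2 / b),
    and the right-hand sides sum to (a + b)^2. *)
Lemma ler_cvnorm2D (R : realType) (n : nat) (x y : 'cV[R]_n) :
  cvnorm2 (x + y) <= cvnorm2 x + cvnorm2 y.
Proof.
have [x0|x0] := eqVneq (cvnorm2 x) 0.
  by rewrite (cvnorm2_eq0 x0) cvnorm20 !add0r.
have [y0|y0] := eqVneq (cvnorm2 y) 0.
  by rewrite (cvnorm2_eq0 y0) cvnorm20 !addr0.
set a := cvnorm2 x in x0 *; set b := cvnorm2 y in y0 *.
have a_gt0 : 0 < a by rewrite lt0r x0 cvnorm2_ge0.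
have b_gt0 : 0 < b by rewrite lt0r y0 cvnorm2_ge0.
rewrite -(ler_pXn2r (n := 2)) ?nnegrE ?addr_ge0 ?cvnorm2_ge0//.
have -> : (a + b) ^+ 2 = (a + b) * (a^-1 * a ^+ 2 + b^-1 * b ^+ 2).
  by field; rewrite x0 y0.
rewrite !sqr_cvnorm2 !mulr_sumr -big_split/= mulr_sumr.
apply: ler_sum => i _.
(* The gap in the entrywise inequality is a multiple of a square. *)
rewrite mxE -subr_ge0.
rewrite [leRHS](_ : _ = a * b * (a^-1 * x i 0 - b^-1 * y i 0) ^+ 2).
  by rewrite mulr_ge0 ?sqr_ge0// ltW// mulr_gt0.
by field; rewrite x0 y0.
Qed.

(** The reverse triangle inequality in each entry; this is all that the proof
    uses about the nonlinear term of the equation. *)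
Lemma cvnorm2_cvabsB (R : realType) (n : nat) (x y : 'cV[R]_n) :
  cvnorm2 (cvabs x - cvabs y) <= cvnorm2 (x - y).
Proof.
rewrite ler_wsqrtr// ler_sum// => i _; rewrite !mxE.
rewrite -[leLHS]real_normK ?num_real// -[leRHS]real_normK ?num_real//.
by rewrite lerXn2r ?nnegrE// ler_dist_dist.
Qed.

(** On the unit ball the entries of [x] are at most 1, so those of [M *m x] are
    at most [n] times the largest entry of [M]. *)
Lemma has_sup_mxnorm2 (R : realType) (m n : nat) (M : 'M[R]_(m, n)) :
  has_sup [set cvnorm2 (M *m x) | x in [set x : 'cV[R]_n | cvnorm2 x <= 1]].
Proof.
split; first by exists (cvnorm2 (M *m 0)), 0 => //=; rewrite cvnorm20 ler01.
exists (m%:R * (n%:R * `|M|)) => _ [x /= x1 <-].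
apply: (le_trans (cvnorm2_le_normr _)); rewrite ler_wpM2l//.
rewrite [leLHS]/Num.norm/= mx_normrE; apply: bigmax_le => [|[i j] _ /=].
  by rewrite mulr_ge0.
rewrite ord1 mxE (le_trans (ler_norm_sum _ _ _))//.
apply: (@le_trans _ _ (\sum_(k < n) `|M|)).
  apply: ler_sum => k _; rewrite normrM -[leRHS]mulr1 ler_pM//.
    exact: ler_entry_mx_norm.
  exact: le_trans (le_trans (ler_entry_mx_norm _ _ _) (normr_le_cvnorm2 _)) x1.
by rewrite sumr_const card_ord mulr_natl.
Qed.

Lemma mxnorm2_ge0 (R : realType) (m n : nat) (M : 'M[R]_(m, n)) :
  0 <= mxnorm2 M.
Proof.
apply: (@le_trans _ _ (cvnorm2 (M *m 0))); first exact: cvnorm2_ge0.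
apply: sup_upper_bound; first exact: has_sup_mxnorm2.
by exists 0 => //=; rewrite cvnorm20 ler01.
Qed.

Lemma cvnorm2_mulmx (R : realType) (m n : nat) (M : 'M[R]_(m, n))
    (x : 'cV[R]_n) :
  cvnorm2 (M *m x) <= mxnorm2 M * cvnorm2 x.
Proof.
have [x0|x0] := eqVneq (cvnorm2 x) 0.
  by rewrite (cvnorm2_eq0 x0) mulmx0 !cvnorm20 mulr0.
have x_gt0 : 0 < cvnorm2 x by rewrite lt0r x0 cvnorm2_ge0.
have xVN : `|(cvnorm2 x)^-1| = (cvnorm2 x)^-1.
  by rewrite ger0_norm// invr_ge0 ltW.
rewrite -ler_pdivrMr// mulrC -xVN -cvnorm2Z scalemxAr.
apply: sup_upper_bound; first exact: has_sup_mxnorm2.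
by exists ((cvnorm2 x)^-1 *: x) => //=; rewrite cvnorm2Z xVN mulVf.
Qed.

(** * Contractions for the Euclidean norm *)

Lemma cvnorm2_iter (R : realType) (n : nat) (T : 'cV[R]_n -> 'cV[R]_n) (q : R) :
    0 <= q ->
    (forall u v, cvnorm2 (T u - T v) <= q * cvnorm2 (u - v)) ->
  forall k u v,
    cvnorm2 (iter k T u - iter k T v) <= q ^+ k * cvnorm2 (u - v).
Proof.
move=> q0 Tq; elim=> [|k IH] u v; first by rewrite mul1r.
by rewrite /= (le_trans (Tq _ _))// exprS -mulrA ler_wpM2l.
Qed.

Lemma cvnorm2_contraction_fix_unique (R : realType) (n : nat)
    (T : 'cV[R]_n -> 'cV[R]_n) (q : R) (u v : 'cV[R]_n) :
    q < 1 -> cvnorm2 (T u - T v) <= q * cvnorm2 (u - v) ->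
  T u = u -> T v = v -> u = v.
Proof.
move=> q1 + Tu Tv; rewrite Tu Tv => uvq.
apply: subr0_eq; apply: cvnorm2_eq0; apply/eqP.
apply: contraTT uvq => uv0.
by rewrite -ltNge gtr_pMl ?lt0r ?uv0 ?cvnorm2_ge0.
Qed.

(** Column vectors are both a normed module and a complete space; the join of
    the two structures is what Banach's theorem asks for. *)
HB.instance Definition _ (R : realType) (n : nat) :=
  Complete.on 'cV[R]_n.

(** Banach's theorem is available for the max norm, for which [T] itself need
    not be a contraction. By equivalence of the norms, some iterate of [T] is
    one, and it has a fixed point [p]. This [p] is also fixed by [T]: the
    iterate fixes [T p] as well, and it can fix only one point. *)
Lemma cvnorm2_contraction_fixpoint (R : realType) (n : nat)
    (T : 'cV[R]_n -> 'cV[R]_n) (q : R) :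
    0 <= q < 1 ->
    (forall u v, cvnorm2 (T u - T v) <= q * cvnorm2 (u - v)) ->
  exists p, T p = p.
Proof.
move=> /andP[q0 q1] Tq.
(* The factor is [n.+1], not [n], so that [q ^+ m < 1] also when [n = 0]. *)
have [m mq] : exists m, n.+1%:R * q ^+ m < 1.
  have /cvgrPdist_lt/(_ 1 ltr01)[N _ /(_ N (leqnn N)) small] :
      geometric n.+1%:R q k @[k --> \oo] --> (0 : R).
    by apply: cvg_geometric; rewrite ger0_norm.
  by exists N; apply: le_lt_trans small; rewrite sub0r normrN ler_norm.
have qm0 : 0 <= q ^+ m by rewrite exprn_ge0.
have c0 : 0 <= n.+1%:R * q ^+ m by rewrite mulr_ge0.
have fixm : is_contraction (totalfun_ setT (iter m T)).
  exists (NngNum c0); split => //= -[u v] _ /=.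
  apply: le_trans (normr_le_cvnorm2 _) _.
  apply: le_trans (cvnorm2_iter q0 Tq m u v) _.
  rewrite -[leRHS]mulrA mulrCA ler_wpM2l//.
  by rewrite (le_trans (cvnorm2_le_normr _))// ler_wpM2r// ler_nat.
have [||p _ pT] := banach_fixed_point fixm; [exact: closedT|by exists 0|].
rewrite /totalfun_ in pT.
exists p; apply: (@cvnorm2_contraction_fix_unique _ _ (iter m T) (q ^+ m)).
- by apply: le_lt_trans mq; rewrite ler_peMl// ler1n.
- exact: cvnorm2_iter.
- by rewrite -iterSr/= -pT.
- by rewrite -pT.
Qed.

Lemma cvnorm2_geometric_cvg (R : realType) (n : nat) (u : nat -> 'cV[R]_n)
    (l : 'cV[R]_n) (C q : R) :
    0 <= q < 1 -> (forall k, cvnorm2 (u k - l) <= C * q ^+ k) ->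
  u k @[k --> \oo] --> l.
Proof.
move=> /andP[q0 q1] uC; apply/cvgrPdist_le => e e0.
have /cvgrPdist_le/(_ e e0) : geometric C q k @[k --> \oo] --> (0 : R).
  by apply: cvg_geometric; rewrite ger0_norm.
apply: filterS => k; rewrite sub0r normrN => /(le_trans (ler_norm _)).
apply: le_trans; rewrite distrC/=.
exact: le_trans (normr_le_cvnorm2 _) (uC k).
Qed.

(** * The iteration map on the auxiliary variable *)

(** The iteration with [x] eliminated: each step recomputes [x] from [y] alone,
    so the [y]-components are the orbit of a self-map of ['cV[R]_n]. *)
Definition mfpi_map (R : realType) (n : nat) (A Q : 'M[R]_n) (b : 'cV[R]_n)
    (tau : R) (y : 'cV[R]_n) : 'cV[R]_n :=
  (1 - tau) *: y + tau *: (invmx Q *m cvabs (invmx A *m (Q *m y + b))).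

Lemma mfpi_snd (R : realType) (n : nat) (A Q : 'M[R]_n) (b : 'cV[R]_n)
    (tau : R) (x0 y0 : 'cV[R]_n) k :
  (mfpi A Q b tau x0 y0 k).2 = iter k (mfpi_map A Q b tau) y0.
Proof. by elim: k => //= k <-. Qed.

(** Relaxation does not change the fixed points: [mfpi_map] is the affine
    combination, with weight [tau] on the unrelaxed map, of that map and the
    identity. *)
Lemma mfpi_map_fixP (R : realType) (n : nat) (A Q : 'M[R]_n) (b : 'cV[R]_n)
    (tau : R) (y : 'cV[R]_n) : tau != 0 ->
  mfpi_map A Q b tau y = y <->
  invmx Q *m cvabs (invmx A *m (Q *m y + b)) = y.
Proof.
move=> tau0; rewrite /mfpi_map; set z := invmx Q *m _; split => [|->].
  rewrite scalerBl scale1r -addrA => /(canRL (addKr _)); rewrite addNr addrC.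
  by move/eqP; rewrite -scalerBr scaler_eq0 (negbTE tau0) subr_eq0 => /eqP.
by rewrite -scalerDl subrK scale1r.
Qed.

(** With y = Q^-1 |x| this says that solutions [x] correspond to the fixed
    points [y] of the unrelaxed map, by x = A^-1 (Q y + b). *)
Lemma abs_eq_solutionP (R : realType) (n : nat) (A Q : 'M[R]_n)
    (b x : 'cV[R]_n) : A \in unitmx -> Q \in unitmx ->
  A *m x - cvabs x - b = 0 <->
  x = invmx A *m (Q *m (invmx Q *m cvabs x) + b).
Proof.
move=> hA hQ; rewrite mulKVmx//; split => [|xE].
  by rewrite -addrA -opprD => /subr0_eq <-; rewrite mulKmx.
by rewrite {1}xE mulKVmx// -addrA -opprD subrr.
Qed.

(** If tau <= 1 the left-hand side is 1 - tau (1 - nu); if tau > 1 it is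
    tau (1 + nu) - 1, and the upper bound on [tau] is what keeps it below 1. *)
Lemma relaxation_factor_lt1 (R : realFieldType) (nu tau : R) :
  0 <= nu < 1 -> 0 < tau < 2 / (1 + nu) -> `|1 - tau| + tau * nu < 1.
Proof.
move=> /andP[nu0 nu1] /andP[tau0].
rewrite ltr_pdivlMr; last by rewrite ltr_wpDr.
rewrite mulrDr mulr1 => tau2.
have tnu : tau * nu < tau by rewrite gtr_pMr.
by rewrite -ltrBrDr ltr_norml; apply/andP; split; lra.
Qed.

(** The linear maps contribute their spectral norms and the absolute value
    contributes the factor 1, so the unrelaxed map has Lipschitz constant
    nu = ||A^-1 Q|| ||Q^-1||. *)
Lemma mfpi_map_lipschitz (R : realType) (n : nat) (A Q : 'M[R]_n)
    (b : 'cV[R]_n) (tau : R) (u v : 'cV[R]_n) : 0 <= tau ->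
  cvnorm2 (mfpi_map A Q b tau u - mfpi_map A Q b tau v) <=
  (`|1 - tau| + tau * (mxnorm2 (invmx A *m Q) * mxnorm2 (invmx Q))) *
    cvnorm2 (u - v).
Proof.
move=> tau0; rewrite /mfpi_map opprD addrACA -!scalerBr -mulmxBr.
apply: le_trans (ler_cvnorm2D _ _) _.
rewrite !cvnorm2Z (ger0_norm tau0) mulrDl lerD2l -mulrA ler_wpM2l//.
apply: le_trans (cvnorm2_mulmx _ _) _.
rewrite mulrAC [leRHS]mulrC ler_wpM2l ?mxnorm2_ge0//.
apply: le_trans (cvnorm2_cvabsB _ _) _.
apply: le_trans (cvnorm2_mulmx _ _).
by rewrite -mulmxBr opprD addrACA subrr addr0 -mulmxBr mulmxA.
Qed.

(** * Convergence of the iteration *)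

Theorem corollary9 (R : realType) (n : nat) (A Q : 'M[R]_n) (tau : R)
    (hA : A \in unitmx) (hQ : Q \in unitmx) (htau : 0 < tau)
    (hnorm : 0 < mxnorm2 (invmx A *m Q) * mxnorm2 (invmx Q) < 1)
    (htau_lt : 0 < tau < 2 / (1 + mxnorm2 (invmx A *m Q) * mxnorm2 (invmx Q)))
    (b : 'cV[R]_n) :
  exists xs : 'cV[R]_n,
    [/\ A *m xs - cvabs xs - b = 0,
        forall x : 'cV[R]_n, A *m x - cvabs x - b = 0 -> x = xs
      & forall x0 y0 : 'cV[R]_n,
          mfpi A Q b tau x0 y0 k @[k --> \oo] --> (xs, invmx Q *m cvabs xs)].
Proof.
have tau_neq0 : tau != 0 by rewrite gt_eqF.
set q := `|1 - tau| +
  tau * (mxnorm2 (invmx A *m Q) * mxnorm2 (invmx Q)).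
have q01 : 0 <= q < 1.
  case/andP: hnorm => nu0 nu1.
  rewrite relaxation_factor_lt1 ?nu1 ?(ltW nu0)// andbT.
  by rewrite addr_ge0// mulr_ge0 ?ltW.
have /andP[q0 q1] := q01.
have Tq u v := mfpi_map_lipschitz A Q b u v (ltW htau).
have [ys ysT] := cvnorm2_contraction_fixpoint q01 Tq.
have ysE := (mfpi_map_fixP A Q b ys tau_neq0).1 ysT.
set xs := invmx A *m (Q *m ys + b) in ysE.
exists xs; rewrite ysE; split.
- by apply/(abs_eq_solutionP b xs hA hQ); rewrite ysE.
- move=> x /(abs_eq_solutionP b x hA hQ) xE.
  have yT : mfpi_map A Q b tau (invmx Q *m cvabs x) = invmx Q *m cvabs x.
    by apply/mfpi_map_fixP; rewrite -?xE.
  suff yE : invmx Q *m cvabs x = ys by rewrite xE yE.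
  exact: cvnorm2_contraction_fix_unique q1 (Tq _ _) yT ysT.
move=> x0 y0.
have ybound k : cvnorm2 ((mfpi A Q b tau x0 y0 k).2 - ys) <=
    cvnorm2 (y0 - ys) * q ^+ k.
  rewrite mfpi_snd mulrC -{1}(iter_fix k ysT).
  exact: cvnorm2_iter.
(* The first component at step [k.+1] is an affine image of the second one at
   step [k], so it inherits the geometric error bound after a shift. *)
have ycvg := cvnorm2_geometric_cvg q01 ybound.
have xcvg : (mfpi A Q b tau x0 y0 k).1 @[k --> \oo] --> xs.
  rewrite -(cvg_shiftS (fun k => (mfpi A Q b tau x0 y0 k).1)).
  apply: (cvnorm2_geometric_cvg
    (C := mxnorm2 (invmx A *m Q) * cvnorm2 (y0 - ys)) q01) => k.
  rewrite /= /xs -mulmxBr opprD addrACA subrr addr0 -mulmxBr mulmxA.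
  apply: le_trans (cvnorm2_mulmx _ _) _.
  by rewrite -mulrA ler_wpM2l ?mxnorm2_ge0.
rewrite (_ : mfpi A Q b tau x0 y0 = fun k =>
  ((mfpi A Q b tau x0 y0 k).1, (mfpi A Q b tau x0 y0 k).2)).
  exact: cvg_pair xcvg ycvg.
by apply/funext => k; rewrite -surjective_pairing.
Qed.
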